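(* Let $(R_d)_{d\ge 1}$ be a sequence of positive real numbers with $\frac{R_d}{\sqrt d}\to\infty$ as $d\to\infty$. For $R>0$ let $\Lambda_{d,R}=\mathbb Z^d\cap\{x\in\mathbb R^d:\|x\|_2\le R\}$. Then \[ \lim_{d\to\infty}\left(\frac{E(\Lambda_{d,R_d})}{|\Lambda_{d,R_d}|^3}\right)^{1/d}=\frac{4\sqrt3}{9}. \]
   Context: For a finite subset $A$ of an abelian group, the additive energy of $A$ is $E(A)=\#\{(a_1,a_2,a_3,a_4)\in A^4: a_1+a_2=a_3+a_4\}$. $\|\cdot\|_2$ is the Euclidean norm on $\mathbb R^d$. *)

(* Defs.v *)
From HB Require Import structures.
From mathcomp Require Export all_boot all_order all_algebra finmap.
From mathcomp Require Export all_classical all_reals all_analysis.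
Export numFieldNormedType.Exports.

Set Implicit Arguments.
Unset Strict Implicit.
Unset Printing Implicit Defensive.

Import Order.TTheory GRing.Theory Num.Theory.

Local Open Scope classical_set_scope.
Local Open Scope fset_scope.
Local Open Scope ring_scope.

(* A quadruple (a1, a2, a3, a4) is encoded as ((a1, a2), (a3, a4)). *)
Definition additive_energy (V : zmodType) (A : {fset V}) : nat :=
  #|` [fset q in (A `*` A) `*` (A `*` A) | q.1.1 + q.1.2 == q.2.1 + q.2.2] |.

(* The norm of the library on matrices is the sup norm. *)
Definition euclidean_norm (R : realType) (d : nat) (x : 'rV[R]_d) : R :=
  Num.sqrt (\sum_(i < d) x ord0 i ^+ 2).

Definition lattice_ball_set (R : realType) (d : nat) (r : R) : set 'rV[int]_d :=
  [set z | euclidean_norm (map_mx intr z : 'rV[R]_d) <= r].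
Arguments lattice_ball_set {R} d r _.

(* [fset_set] is junk on infinite sets; see [finite_lattice_ball_set]. *)
Definition lattice_ball (R : realType) (d : nat) (r : R) : {fset 'rV[int]_d} :=
  fset_set (lattice_ball_set d r).
Arguments lattice_ball {R} d r.

Lemma finite_lattice_ball_set (R : realType) (d : nat) (r : R) :
  finite_set (lattice_ball_set d r).
Proof.
pose N := Num.bound `|r|.
pose f (y : 'rV['I_(N + N).+1]_d) : 'rV[int]_d :=
  \row_i ((y ord0 i)%:Z - N%:Z).
apply: (@sub_finite_set _ _ (f @` [set: 'rV['I_(N + N).+1]_d])); last first.
  by apply: finite_image; exact: finite_finset.
move=> z zr.
have zN i : `|z ord0 i| <= N%:Z.
  rewrite -(ler_int R) intr_norm -[(N%:Z)%:~R]/(N%:R).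
  apply: le_trans (ltW (le_lt_trans (ler_norm r) (archi_boundP (normr_ge0 r)))) => //.
  apply: le_trans zr; rewrite /euclidean_norm -sqrtr_sqr ler_wsqrtr//.
  rewrite (bigD1 i)//= mxE lerDl sumr_ge0// => j _; exact: sqr_ge0.
exists (\row_i inord (absz (z ord0 i + N%:Z))) => //.
apply/rowP => i; rewrite !mxE.
have := zN i; rewrite ler_norml => /andP[z1 z2].
have z0 : 0 <= z ord0 i + N%:Z by rewrite -lerBlDr sub0r.
rewrite inordK; first by rewrite gez0_abs// addrK.
by rewrite ltnS -lez_nat gez0_abs// PoszD lerD2r.
Qed.

Lemma mem_lattice_ball (R : realType) (d : nat) (r : R) (z : 'rV[int]_d) :
  (z \in lattice_ball d r) = (euclidean_norm (map_mx intr z : 'rV[R]_d) <= r).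
Proof.
rewrite in_fset_set; last exact: finite_lattice_ball_set.
by apply/idP/idP; rewrite inE.
Qed.

(* Main.v *)
Require Import Defs.
From mathcomp Require Import ring lra zify.

(* Each count is a lattice-point count: |Λ| counts the x in Z^d with |x|^2 <= r^2,
   and E(Λ) counts the d-tuples of elements of the rank 3 lattice
   {a in Z^4 : a_1 + a_2 = a_3 + a_4} whose four coordinate vectors all have squared
   norm at most r^2.  Both are handled by Cramér's method: if Z(λ) is the sum of
   exp(-λ |a|^2) over a lattice of rank m in Z^K, then Chernoff's bound gives
   count <= (exp(λ K r^2 / d) Z(λ))^d.  Conversely, the weights exp(-λ |a|^2), with λ
   slightly above m d / (2 K r^2), put the mean of each of the K squared norms (equal by
   symmetry) slightly below r^2, and two more Chernoff bounds show that most of the mass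
   satisfies all the constraints.  Since λ -> 0, Z(λ) is a Riemann sum of a Gaussian
   integral: Z(λ) ~ (pi/λ)^(1/2) for Z and Z(λ) ~ (pi/λ)^(3/2) / 2 for the rank 3
   lattice, so that E^(1/d) / (|Λ|^(1/d))^3 tends to (4/3)^(3/2) / 2 = 4 sqrt 3 / 9. *)

Set Implicit Arguments.
Unset Strict Implicit.
Unset Printing Implicit Defensive.

Import Order.TTheory GRing.Theory Num.Theory.

Local Open Scope classical_set_scope.
Local Open Scope fset_scope.
Local Open Scope ring_scope.

(** * Cramér bounds for finite sums *)

Section FiniteCramer.
Variables (R : realType) (k : nat) (T : finType) (g : 'I_k.+1 -> T -> R).
Hypothesis g_ge0 : forall j t, 0 <= g j t.

Definition total_cost (t : T) : R := \sum_j g j t.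

Definition partition_function (a : R) : R := \sum_t expR (- a * total_cost t).

(** The budget is normalised to one per letter; a bound r^2 on a squared norm takes this form after
    scaling by d / r^2. *)
Definition admissible (d : nat) : pred {ffun 'I_d -> T} :=
  fun x => [forall j, \sum_i g j (x i) <= d%:R].
Arguments admissible : clear implicits.

Lemma partition_function_ge0 a : 0 <= partition_function a.
Proof. by apply: sumr_ge0 => t _; exact: expR_ge0. Qed.

Lemma sum_ffun_expR d (f : T -> R) :
  \sum_(x : {ffun 'I_d -> T}) expR (\sum_i f (x i)) = (\sum_t expR (f t)) ^+ d.
Proof.
under eq_bigr do rewrite expR_sum.
by rewrite -(bigA_distr_bigA (fun _ t => expR (f t))) prodr_const card_ord.
Qed.

Lemma sum_total_cost d (x : {ffun 'I_d -> T}) :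
  \sum_i total_cost (x i) = \sum_j \sum_i g j (x i).
Proof. by rewrite exchange_big. Qed.

Lemma card_sum (S : finType) (P : pred S) : #|P|%:R = \sum_x (P x)%:R :> R.
Proof.
rewrite -sum1_card natr_sum big_mkcond/=; apply: eq_bigr => x _.
by rewrite unfold_in; case: (P x).
Qed.

(** Chernoff: by adding the K = k + 1 constraints, an admissible word has total cost at most K d, so
    its indicator is at most exp(a (K d - cost)), and the sum over all words factorises. *)
Lemma card_admissible_le d (a : R) : 0 <= a ->
  #|admissible d|%:R <= (expR (a * k.+1%:R) * partition_function a) ^+ d.
Proof.
move=> a0; rewrite exprMn -expRM_natr -sum_ffun_expR big_distrr/= card_sum.
apply: ler_sum => x _; case: (boolP (admissible d x)) => [/forallP xP|_]; last first.
  by rewrite mulr_ge0 ?expR_ge0.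
rewrite -expRD -mulr_sumr -[leLHS]expR0 ler_expR mulNr -mulrA -mulrBr.
rewrite mulr_ge0// subr_ge0 sum_total_cost mulr_natl.
by apply: (le_trans (ler_sum _ (fun j _ => xP j))); rewrite sumr_const card_ord.
Qed.

(** For y >= 1 the last term dominates; for y < 1, multiply [(1 - y) * expR y <= 1] by 1 + y. *)
Lemma expR_le_quadratic (y : R) : 0 <= y -> expR y <= 1 + y + y ^+ 2 * expR y.
Proof.
move=> y0; have [y1|y1] := leP 1 y.
  have : 1 <= y ^+ 2 by rewrite exprn_ege1.
  by have := expR_gt0 y; nra.
have : (1 - y) * expR y <= 1.
  have := expR_ge1Dx (- y); rewrite expRN -(ler_pM2r (expR_gt0 y)).
  by rewrite mulVf// gt_eqF// expR_gt0.
by nra.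
Qed.

(** All costs have the same mean under the exponential weights, so each is controlled through the
    total. *)
Hypothesis g_sym : forall (a : R) j, \sum_t g j t * expR (- a * total_cost t) =
  \sum_t g ord0 t * expR (- a * total_cost t).

Lemma sum_cost_sym (a : R) j : \sum_t g j t * expR (- a * total_cost t) =
  (\sum_t total_cost t * expR (- a * total_cost t)) / k.+1%:R.
Proof.
under [in RHS]eq_bigr do rewrite mulr_suml.
rewrite exchange_big/= (eq_bigr _ (fun j _ => g_sym a j)) sumr_const card_ord.
by rewrite g_sym -[X in _ = X / _]mulr_natr mulfK// pnatr_eq0.
Qed.

Lemma total_cost_ge0 t : 0 <= total_cost t.
Proof. exact: sumr_ge0. Qed.

Lemma cost_le_total j t : g j t <= total_cost t.
Proof. by rewrite /total_cost (bigD1 j)//= lerDl sumr_ge0. Qed.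

(* Expand the tilt [y = th * K * a * g j t] to first order, with K = k + 1: by
   symmetry its linear term averages to [th * a * total_cost t]. *)
Lemma sum_tilted_le (a th : R) j : 0 <= a -> 0 <= th -> th * k.+1%:R <= 4^-1 ->
  \sum_t expR (- a * total_cost t + th * k.+1%:R * a * g j t) <=
  partition_function (a * (1 - th)) +
    16 * (th * k.+1%:R) ^+ 2 * partition_function (a / 4).
Proof.
move=> a0 th0; set K : R := k.+1%:R => thK.
have K0 : 0 <= K by rewrite /K ler0n.
set ka : R := th * K; have ka0 : 0 <= ka by rewrite mulr_ge0.
apply: (@le_trans _ _ (\sum_t (expR (- a * total_cost t) +
   ka * a * (g j t * expR (- a * total_cost t)) +
   16 * ka ^+ 2 * expR (- (a / 4) * total_cost t)))).
  apply: ler_sum => t _.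
  have g0 := g_ge0 j t; have gG := cost_le_total j t; have G0 := total_cost_ge0 t.
  rewrite expRD.
  have y0 : 0 <= ka * a * g j t by rewrite !mulr_ge0.
  set y : R := ka * a * g j t in y0 *.
  set x : R := a / 4 * total_cost t.
  have x0 : 0 <= x by rewrite /x mulr_ge0// divr_ge0.
  have yx : y <= 4 * ka * x.
    have -> : 4 * ka * x = ka * a * total_cost t by rewrite /x; field.
    by rewrite ler_wpM2l// mulr_ge0.
  have yx' : y <= x by rewrite (le_trans yx)// ler_piMl//; rewrite -/ka in thK; lra.
  have E : expR (- a * total_cost t) = expR (- (4 * x)) by congr expR; rewrite /x; field.
  have E2 : expR (- (a / 4) * total_cost t) = expR (- x) by congr expR; rewrite /x mulNr.
  rewrite E E2.
  have /le_trans := ler_wpM2l (expR_ge0 (- (4 * x))) (expR_le_quadratic y0); apply.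
  (* The weight has exponent -4 x. The bounds [x ^+ 2 <= expR x ^+ 2] and [y <= x] spend three
     quarters of it; the last quarter yields [partition_function (a / 4)]. *)
  have H1 : x ^+ 2 * expR (- (4 * x)) * expR y <= expR (- x).
    have xe : x <= expR x by have := expR_ge1Dx x; lra.
    have : x ^+ 2 <= expR x ^+ 2 by rewrite lerXn2r// nnegrE ?expR_ge0.
    rewrite -expRM_natl => x2.
    apply: (@le_trans _ _ (expR (2 * x) * expR (- (4 * x)) * expR y)).
      by rewrite ler_wpM2r ?expR_ge0// ler_wpM2r ?expR_ge0.
    by rewrite -!expRD ler_expR; lra.
  have H2 : y ^+ 2 <= 16 * ka ^+ 2 * x ^+ 2.
    have -> : 16 * ka ^+ 2 * x ^+ 2 = (4 * ka * x) ^+ 2 by ring.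
    by rewrite lerXn2r// nnegrE// !mulr_ge0.
  have Ey : expR (- (4 * x)) * y = ka * a * (g j t * expR (- (4 * x))) by rewrite /y; ring.
  have H3 : y ^+ 2 * (expR (- (4 * x)) * expR y) <= 16 * ka ^+ 2 * expR (- x).
    apply: (@le_trans _ _ (16 * ka ^+ 2 * x ^+ 2 * (expR (- (4 * x)) * expR y))).
      by rewrite ler_wpM2r// mulr_ge0// expR_ge0.
    rewrite -mulrA [x ^+ 2 * _]mulrA ler_wpM2l// mulr_ge0//.
    exact: sqr_ge0.
  by move: Ey H3; lra.
rewrite !big_split/= -!mulr_sumr -/(partition_function _) lerD2r.
(* By symmetry [g j] averages to [total_cost / K]; then 1 + u <= exp(u) absorbs the linear term into
   [partition_function (a * (1 - th))]. *)
rewrite sum_cost_sym -/K [X in _ + X](_ : _ =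
    \sum_t th * a * (total_cost t * expR (- a * total_cost t))).
  rewrite -big_split/=; apply: ler_sum => t _.
  have -> : - (a * (1 - th)) * total_cost t =
    - a * total_cost t + th * a * total_cost t by ring.
  rewrite [in leRHS]expRD.
  have := ler_wpM2l (expR_ge0 (- a * total_cost t)) (expR_ge1Dx (th * a * total_cost t)).
  lra.
by rewrite -mulr_sumr /ka mulrA mulrAC [th * K * a]mulrAC mulfK// pnatr_eq0.
Qed.

(* The mass of the weights [expR (- a * total_cost)] is the partition function; the two
   subtracted terms are Chernoff bounds for the part where the total cost is below
   [K * nu * d], and for the part where some constraint fails. *)
Lemma card_admissible_ge d (a th nu : R) : 0 <= a -> 0 <= th -> th * k.+1%:R <= 4^-1 ->
  expR (a * k.+1%:R * nu) ^+ d *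
   (partition_function a ^+ d
    - (expR (th * k.+1%:R * a * k.+1%:R * nu) *
         partition_function (a * (1 + th * k.+1%:R))) ^+ d
    - k.+1%:R * (expR (- (th * k.+1%:R * a)) *
       (partition_function (a * (1 - th)) +
        16 * (th * k.+1%:R) ^+ 2 * partition_function (a / 4))) ^+ d)
  <= #|admissible d|%:R.
Proof.
move=> a0 th0; set K : R := k.+1%:R => thK.
have K0 : 0 <= K by rewrite /K ler0n.
set ka : R := th * K; have ka0 : 0 <= ka by rewrite mulr_ge0.
set Z := partition_function; set D : R := d%:R.
pose S (x : {ffun 'I_d -> T}) := \sum_i total_cost (x i).
rewrite mulrC -ler_pdivlMr ?exprn_gt0 ?expR_gt0// -expRM_natr -expRN.
rewrite !lerBlDr.
(* The weight of [x] is at most one of three nonnegative terms: the first if [x] is admissible of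
   cost at least K nu d, the third if it is admissible and cheaper, a summand of the second if a
   constraint fails. *)
apply: (@le_trans _ _ (\sum_x ((admissible d x)%:R * expR (- (a * K * nu * D)) +
   \sum_(j < k.+1) expR (- (ka * a) * D) *
     expR (\sum_i (- a * total_cost (x i) + ka * a * g j (x i)))
   + expR (ka * a * K * nu * D) * expR (\sum_i - (a * (1 + ka)) * total_cost (x i))))); last first.
  rewrite !big_split/=; apply: lerD; [apply: lerD|].
  - by rewrite -mulr_suml -card_sum.
  - rewrite exchange_big/=.
    apply: (le_trans (ler_sum _ (G := fun j => (expR (- (ka * a)) *
        (Z (a * (1 - th)) + 16 * ka ^+ 2 * Z (a / 4))) ^+ d) _)).
      move=> j _; rewrite -mulr_sumr.
      rewrite (sum_ffun_expR d (fun t => - a * total_cost t + ka * a * g j t)).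
      rewrite expRM_natr -exprMn.
      rewrite lerXn2r ?nnegrE ?mulr_ge0 ?expR_ge0//.
      + by apply: sumr_ge0 => t _; exact: expR_ge0.
      + by rewrite addr_ge0 ?mulr_ge0 ?partition_function_ge0 ?sqr_ge0.
      + by rewrite ler_wpM2l ?expR_ge0// sum_tilted_le.
    by rewrite sumr_const card_ord -[leLHS]mulr_natl.
  - rewrite -mulr_sumr (sum_ffun_expR d (fun t => - (a * (1 + ka)) * total_cost t)).
    by rewrite expRM_natr -exprMn.
rewrite /Z /partition_function -sum_ffun_expR; apply: ler_sum => x _.
rewrite -mulr_sumr -/(S x).
have [xP|] := boolP (admissible d x); last first.
  rewrite negb_forall => /existsP[j]; rewrite -ltNge => xj.
  rewrite mul0r add0r (bigD1 j)//= -!expRD.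
  apply: ler_wpDr; first by rewrite expR_ge0.
  apply: ler_wpDr; first by apply: sumr_ge0 => i _; rewrite mulr_ge0 ?expR_ge0.
  rewrite ler_expR big_split/= -!mulr_sumr -/(S x).
  have : ka * a * D <= ka * a * \sum_i g j (x i) by rewrite ler_wpM2l ?mulr_ge0// ltW.
  by lra.
rewrite mul1r -expRD.
have S1 : 0 <= \sum_(j < k.+1) expR (- (ka * a) * D) *
    expR (\sum_i (- a * total_cost (x i) + ka * a * g j (x i))).
  by apply: sumr_ge0 => i _; rewrite mulr_ge0 ?expR_ge0.
have [le|lt] := leP (K * nu * D) (S x).
  rewrite -addrA; apply: ler_wpDr; first by rewrite addr_ge0 ?expR_ge0.
  by rewrite ler_expR -!mulr_sumr -/(S x); have := ler_wpM2l a0 le; lra.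
apply: ler_wpDl; first by rewrite addr_ge0 ?expR_ge0.
rewrite ler_expR -!mulr_sumr -/(S x).
by have := ler_wpM2l (mulr_ge0 ka0 a0) (ltW lt); lra.
Qed.

End FiniteCramer.
Arguments admissible {R k T} g d _.

(** * The exponential growth rate *)

Lemma powR_exprn_root (R : realType) (d : nat) (x : R) : (0 < d)%N -> 0 <= x ->
  (x ^+ d) `^ (d%:R^-1) = x.
Proof.
by move=> d0 x0; rewrite -powR_mulrn// -powRrM mulfV ?powRr1// pnatr_eq0 -lt0n.
Qed.

(** The gap between the limits leaves room for [q < 1], chosen with [q * lv] their midpoint; after
    d-th powers [u] becomes negligible. *)
Lemma near_le_scaled (R : realType) (u v : nat -> R) (lu lv : R) :
  u d @[d --> \oo] --> lu -> v d @[d --> \oo] --> lv -> 0 <= lu -> lu < lv ->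
  exists2 q : R, 0 <= q < 1 & \forall d \near \oo, u d <= q * v d.
Proof.
move=> ulu vlv lu0 luv.
have lv0 : 0 < lv by exact: le_lt_trans luv.
exists ((lu + lv) / (2 * lv)).
  rewrite divr_ge0 ?addr_ge0 ?mulr_ge0 ?(ltW lv0)//=.
  by rewrite ltr_pdivrMr ?mulr_gt0//; lra.
have cv : (lu + lv) / (2 * lv) * v d - u d @[d --> \oo] -->
    (lu + lv) / (2 * lv) * lv - lu.
  by apply: cvgB => //; exact: cvgMl_tmp.
have H : 0 < (lu + lv) / (2 * lv) * lv - lu.
  have -> : (lu + lv) / (2 * lv) * lv - lu = (lv - lu) / 2.
    by field; rewrite gt_eqF.
  by rewrite divr_gt0// subr_gt0.
near=> d; rewrite -subr_ge0; apply: ltW.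
by near: d; exact: (cvgr_gt _ cv _ H).
Unshelve. all: by end_near. Qed.

Lemma cvg_powR_invn (R : realType) (x : R) : 0 < x ->
  x `^ (d%:R^-1) @[d --> \oo] --> (1 : R).
Proof.
move=> x0.
have cvg0 : (d%:R^-1 : R) @[d --> \oo] --> (0 : R).
  rewrite gtr0_cvgV0; first exact: cvgr_idn.
  by exists 1%N => // n /= n1; rewrite ltr0n.
have cvgl : d%:R^-1 * ln x @[d --> \oo] --> 0 * ln x by exact: cvgMr_tmp.
have := cvg_comp _ _ cvgl (@continuous_expR R (0 * ln x)).
rewrite mul0r expR0; apply: cvg_trans; apply: near_eq_cvg; apply: nearW => d.
by rewrite /= /powR gt_eqF.
Qed.

Lemma ln_ge1BV (R : realType) (x : R) : 0 < x -> 1 - x^-1 <= ln x.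
Proof.
move=> x0; rewrite -[leRHS]opprK -lnV// lerNr opprB.
have := @le_ln1Dx R (x^-1 - 1); rewrite addrCA subrr addr0; apply.
by rewrite ltrBrDr addrC subrr invr_gt0.
Qed.

(** * The limit of the normalised d-th roots *)

Section CramerLimit.
Variables (R : realType) (k : nat) (T : nat -> finType).
Variables (g : forall d, 'I_k.+1 -> T d -> R) (b : nat -> R) (c s : R).
Arguments g : clear implicits.
Hypothesis g_ge0 : forall d j t, 0 <= g d j t.
Hypothesis g_sym : forall d (a : R) j,
  \sum_t g d j t * expR (- a * total_cost (g d) t) =
  \sum_t g d ord0 t * expR (- a * total_cost (g d) t).
Hypotheses (b_ge0 : forall d, 0 <= b d) (c_gt0 : 0 < c) (s_gt0 : 0 < s).
(** The Gaussian asymptotics c a^(-s): 2 s is the rank of the lattice and [b] the scale that keeps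
    the limit finite. *)
Hypothesis cvg_partition : forall a : R, 0 < a ->
  b d * partition_function (g d) a @[d --> \oo] --> c * expR (- (s * ln a)).

Let K : R := k.+1%:R.
Let N d : R := #|admissible (g d) d|%:R.
(** The minimum over a > 0 of exp(a K) c a^(-s), attained at a = s / K. *)
Let L : R := c * expR (s * (1 + ln (K / s))).

Let K_gt0 : 0 < K. Proof. by rewrite /K ltr0n. Qed.

Let L_gt0 : 0 < L. Proof. by rewrite mulr_gt0// expR_gt0. Qed.

Let ln_ratio : ln (s / K) = - ln (K / s).
Proof. by rewrite -lnV ?posrE ?divr_gt0// invf_div. Qed.

Lemma root_card_le : \forall d \near \oo, b d * N d `^ (d%:R^-1) <=
  expR (s / K * K) * (b d * partition_function (g d) (s / K)).
Proof.
near=> d.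
have d0 : (0 < d)%N by near: d; exact: nbhs_infty_gt.
rewrite mulrCA ler_wpM2l//.
have sK : 0 <= s / K by rewrite divr_ge0// ltW.
have x0 : 0 <= expR (s / K * K) * partition_function (g d) (s / K).
  by rewrite mulr_ge0 ?expR_ge0 ?partition_function_ge0.
rewrite -[leRHS](powR_exprn_root d0 x0) ge0_ler_powR ?nnegrE ?invr_ge0 ?exprn_ge0//.
exact: card_admissible_le.
Unshelve. all: by end_near. Qed.

Lemma cvg_upper :
  expR (s / K * K) * (b d * partition_function (g d) (s / K)) @[d --> \oo] --> L.
Proof.
rewrite /L; have -> : c * expR (s * (1 + ln (K / s))) =
    expR (s / K * K) * (c * expR (- (s * ln (s / K)))).
  rewrite mulrCA -expRD; congr (_ * expR _).
  by rewrite ln_ratio divfK ?gt_eqF//; ring.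
by apply: cvgMl_tmp; apply: cvg_partition; rewrite divr_gt0.
Qed.

(* [a = (s/K)(1+de)] tilts the mean of each constraint to [1/(1+de)]. *)
Lemma root_card_ge (de : R) : 0 < de <= 1 ->
  \forall d \near \oo, L * expR (- (3 * s * de)) <= b d * N d `^ (d%:R^-1).
Proof.
move=> /andP[de0 de1].
have K0 := K_gt0.
pose a := s / K * (1 + de).
have a0 : 0 < a by rewrite mulr_gt0 ?divr_gt0// addr_gt0.
(* [A * th ^+ 2] is the limit of [16 * ka ^+ 2 * z d (a / 4)] relative to [z d a]. *)
pose A := 16 * K ^+ 2 * expR (s * ln 4).
have A0 : 0 < A by rewrite !mulr_gt0 ?exprn_gt0 ?expR_gt0.
(* Small enough for the second-order loss th^2 (2 s + A) to stay below the first-order gain th s de,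
   and for th K <= 1/4. *)
pose th := de / (4 * K * (2 + A / s)).
have As0 : 0 < 2 + A / s by rewrite addr_gt0// divr_gt0.
have th0 : 0 < th by rewrite divr_gt0 ?mulr_gt0.
have thKE : th * K * (4 * (2 + A / s)) = de.
  rewrite /th; field; rewrite !gt_eqF//; apply: addr_gt0 => //.
  by rewrite mulr_gt0.
pose ka := th * K.
have ka0 : 0 < ka by rewrite mulr_gt0.
have As2 : 0 < A / s by rewrite divr_gt0.
have ka8 : 8 * ka <= de.
  by rewrite -thKE -/ka [leLHS]mulrC ler_wpM2l ?(ltW ka0)//; lra.
have K1 : 1 <= K by rewrite /K ler1n.
have thka : th <= ka by rewrite /ka ler_peMr// ltW.
(* K nu lies below K / (1 + de), the limiting mean of the total cost per letter, so that lower
   totals are atypical. *)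
pose nu := (1 + de) ^- 2.
pose W := expR (a * K * nu).
have aK : a * K = s * (1 + de) by rewrite /a; field; rewrite gt_eqF.
have aKnu : a * K * nu = s / (1 + de).
  by rewrite aK /nu; field; rewrite gt_eqF// addr_gt0.
pose z d x := b d * partition_function (g d) x.
(* Up to the factor K of the second, [B1] and [B2] are the d-th roots, scaled by [b], of the two
   terms to be subtracted. *)
pose B1 d := expR (ka * a * K * nu) * z d (a * (1 + ka)).
pose B2 d := expR (- (ka * a)) * (z d (a * (1 - th)) + 16 * ka ^+ 2 * z d (a / 4)).
have th1 : 0 < 1 - th by lra.
have zl := cvg_partition a0.
have l0 : 0 < c * expR (- (s * ln a)) by rewrite mulr_gt0 ?expR_gt0.
(* Relative to the limit of [z d a], the claim is ka / (1 + de) < ln(1 + ka), which holds as ka <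
   de. *)
have [q1 /andP[q10 q11] B1q] : exists2 q : R, 0 <= q < 1 &
    \forall d \near \oo, B1 d <= q * z d a.
  have cB1 : B1 d @[d --> \oo] -->
      expR (ka * a * K * nu) * (c * expR (- (s * ln (a * (1 + ka))))).
    apply: cvgMl_tmp; apply: cvg_partition.
    by rewrite mulr_gt0// addr_gt0.
  apply: (near_le_scaled cB1 zl); first by rewrite !mulr_ge0 ?expR_ge0 ?ltW.
  rewrite mulrCA ltr_pM2l// -expRD ltr_expR lnM ?posrE ?addr_gt0//.
  have -> : ka * a * K * nu = s * (ka / (1 + de)).
    rewrite -[s * _]mulrCA -aKnu; ring.
  rewrite -subr_lt0.
  have -> : s * (ka / (1 + de)) + - (s * (ln a + ln (1 + ka))) - - (s * ln a) =
    s * (ka / (1 + de) - ln (1 + ka)) by ring.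
  rewrite pmulr_rlt0// subr_lt0.
  apply: (@lt_le_trans _ _ (ka / (1 + ka))).
    by rewrite ltr_pM2l// ltf_pV2 ?posrE; lra.
  have ka1 : 0 < 1 + ka by lra.
  have -> : ka / (1 + ka) = 1 - (1 + ka)^-1 by field; rewrite gt_eqF.
  exact: ln_ge1BV.
(* Here the claim is (1 - th)^(-s) + A th^2 < exp(s th (1 + de)); since 1 / (1 - th) <= 1 + 2 th, it
   follows from th (2 s + A) < s de. *)
have [q2 /andP[q20 q21] B2q] : exists2 q : R, 0 <= q < 1 &
    \forall d \near \oo, B2 d <= q * z d a.
  have cB2 : B2 d @[d --> \oo] -->
      expR (- (ka * a)) * (c * expR (- (s * ln (a * (1 - th)))) +
         16 * ka ^+ 2 * (c * expR (- (s * ln (a / 4))))).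
    apply: cvgMl_tmp; apply: cvgD; first by apply: cvg_partition; rewrite mulr_gt0.
    by apply: cvgMl_tmp; apply: cvg_partition; rewrite divr_gt0.
  apply: (near_le_scaled cB2 zl).
    apply: mulr_ge0; first exact: expR_ge0.
    apply: addr_ge0; first by rewrite mulr_ge0 ?expR_ge0 ?ltW.
    by rewrite mulr_ge0 ?(mulr_ge0 (ltW c_gt0)) ?expR_ge0// mulr_ge0// sqr_ge0.
  have ln4 : ln (4^-1 : R) = - ln 4 by rewrite lnV ?posrE.
  rewrite (@lnM _ a (1 - th)) ?posrE// (@lnM _ a 4^-1) ?posrE ?invr_gt0// ln4.
  have -> : c * expR (- (s * (ln a + ln (1 - th)))) =
      c * expR (- (s * ln a)) * expR (- (s * ln (1 - th))).
    by rewrite -mulrA -expRD; congr (_ * expR _); ring.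
  have -> : 16 * ka ^+ 2 * (c * expR (- (s * (ln a - ln 4)))) =
      c * expR (- (s * ln a)) * (A * th ^+ 2).
    have -> : expR (- (s * (ln a - ln 4))) = expR (- (s * ln a)) * expR (s * ln 4).
      by rewrite -expRD; congr expR; ring.
    by rewrite /A /ka; ring.
  rewrite -mulrDr mulrCA gtr_pMr// (expRN (ka * a)) mulrC ltr_pdivrMr ?expR_gt0// mul1r.
  have x0 : 0 <= s * (th / (1 - th)) by apply/ltW/mulr_gt0 => //; exact: divr_gt0.
  have y0 : 0 <= A * th ^+ 2 by apply: mulr_ge0; [exact: ltW|exact: sqr_ge0].
  apply: (@le_lt_trans _ _ (expR (s * (th / (1 - th))) * expR (A * th ^+ 2))).
    apply: (@le_trans _ _ (expR (s * (th / (1 - th))) + A * th ^+ 2)).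
      rewrite lerD2r ler_expR -mulrN ler_wpM2l ?(ltW s_gt0)// lerNl.
      have -> : - (th / (1 - th)) = 1 - (1 - th)^-1 by field; rewrite gt_eqF.
      exact: ln_ge1BV.
    apply: (@le_trans _ _ (expR (s * (th / (1 - th))) * (1 + A * th ^+ 2))).
      rewrite mulrDr mulr1 lerD2l ler_peMl//.
      by have := expR_ge1Dx (s * (th / (1 - th))); move: x0; lra.
    by rewrite ler_wpM2l ?expR_ge0// expR_ge1Dx.
  rewrite -expRD ltr_expR.
  have -> : ka * a = s * th * (1 + de) by rewrite /ka -mulrA [K * a]mulrC aK; ring.
  have I1 : (1 - th)^-1 <= 1 + 2 * th.
    by rewrite -[leLHS]mul1r ler_pdivrMr//; nra.
  have I2 : s * (th / (1 - th)) <= s * (th * (1 + 2 * th)).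
    by apply: ler_wpM2l; [exact: ltW|apply: ler_wpM2l => //; exact: ltW].
  have I3 : th * (2 + A / s) < de.
    apply: (@le_lt_trans _ _ (ka * (2 + A / s))); first by rewrite ler_wpM2r// ltW.
    by move: thKE; rewrite -/ka; have := mulr_gt0 ka0 As0; lra.
  have I4 : th * (2 * s + A) < s * de.
    have -> : th * (2 * s + A) = s * (th * (2 + A / s)) by field; rewrite gt_eqF.
    by rewrite ltr_pM2l.
  have I5 : th * (th * (2 * s + A)) < th * (s * de) by rewrite ltr_pM2l.
  by lra.
pose q := Num.max q1 q2.
have q0 : 0 <= q by rewrite le_max q10.
have q_lt1 : q < 1 by rewrite gt_max q11.
(* Eventually below 1/2, so the subtracted terms remove at most half of the mass; the d-th root of
   that half tends to 1. *)
have qd : (1 + K) * q ^+ d @[d --> \oo] --> (1 + K) * 0.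
  by apply: cvgMl_tmp; apply: cvg_expr; rewrite ger0_norm.
have half : (2^-1 : R) `^ (d%:R^-1) @[d --> \oo] --> (1 : R).
  by apply: cvg_powR_invn; rewrite invr_gt0.
have Wl : W * (z d a * (2^-1 : R) `^ (d%:R^-1)) @[d --> \oo] -->
    W * (c * expR (- (s * ln a)) * 1).
  by apply: cvgMl_tmp; apply: cvgM.
(* The losses from s / (1 + de) and s ln(1 + de) are at most s de each; the third s de makes the
   inequality strict. *)
have lt_lim : L * expR (- (3 * s * de)) < W * (c * expR (- (s * ln a)) * 1).
  rewrite mulr1 mulrCA /L -mulrA ltr_pM2l// -!expRD ltr_expR aKnu.
  rewrite /a (@lnM _ (s / K) (1 + de)) ?posrE ?divr_gt0 ?addr_gt0// ln_ratio.
  have J1 : ln (1 + de) <= de by apply: le_ln1Dx; lra.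
  have J2 : 1 - de <= (1 + de)^-1.
    by rewrite -[leRHS]mul1r ler_pdivlMr ?addr_gt0//; nra.
  have J3 := ler_wpM2l (ltW s_gt0) J1.
  have J4 := ler_wpM2l (ltW s_gt0) J2.
  have J5 : 0 < s * de by rewrite mulr_gt0.
  by lra.
near=> d.
have d0 : (0 < d)%N by near: d; exact: nbhs_infty_gt.
apply: (@le_trans _ _ (W * (z d a * (2^-1 : R) `^ (d%:R^-1)))).
  by apply: ltW; near: d; exact: cvgr_gt Wl _ lt_lim.
have za0 : 0 <= z d a by rewrite mulr_ge0// partition_function_ge0.
have W0 : 0 <= W by exact: expR_ge0.
rewrite mulrA -(powR_exprn_root d0 (mulr_ge0 W0 za0)) -(powR_exprn_root d0 (b_ge0 d)).
rewrite -!powRM ?exprn_ge0 ?mulr_ge0 ?partition_function_ge0// ?invr_ge0//.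
rewrite ge0_ler_powR ?nnegrE ?invr_ge0 ?mulr_ge0 ?exprn_ge0 ?mulr_ge0 ?partition_function_ge0//.
have := @card_admissible_ge R k (T d) (g d) (g_ge0 (d:=d)) (g_sym d) d a th nu
  (ltW a0) (ltW th0).
rewrite -/K -/ka => /(_ _)/wrap[]; first lra.
move=> /(ler_wpM2l (exprn_ge0 d (b_ge0 d))); apply: le_trans.
rewrite [leRHS]mulrCA [(W * _) ^+ d]exprMn -[leLHS]mulrA; apply: ler_wpM2l.
  by rewrite exprn_ge0.
rewrite 2!mulrBr [X in _ - X]mulrCA -!exprMn.
have -> : b d * (expR (ka * a * K * nu) * partition_function (g d) (a * (1 + ka))) = B1 d.
  by rewrite /B1 /z; ring.
have -> : b d * (expR (- (ka * a)) * (partition_function (g d) (a * (1 - th)) +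
    16 * ka ^+ 2 * partition_function (g d) (a / 4))) = B2 d.
  by rewrite /B2 /z; ring.
rewrite -/(z d a).
have zx x : 0 <= z d x by rewrite mulr_ge0// partition_function_ge0.
have H1 : B1 d ^+ d <= q ^+ d * z d a ^+ d.
  have B10 : 0 <= B1 d by apply: mulr_ge0 => //; exact: expR_ge0.
  rewrite -exprMn lerXn2r ?nnegrE//; first by apply: mulr_ge0.
  apply: (@le_trans _ _ (q1 * z d a)); first by near: d.
  by rewrite ler_wpM2r// le_max lexx.
have H2 : B2 d ^+ d <= q ^+ d * z d a ^+ d.
  have B20 : 0 <= B2 d.
    apply: mulr_ge0; first exact: expR_ge0.
    by apply: addr_ge0 => //; apply: mulr_ge0 => //; rewrite mulr_ge0// sqr_ge0.
  rewrite -exprMn lerXn2r ?nnegrE//; first by apply: mulr_ge0.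
  apply: (@le_trans _ _ (q2 * z d a)); first by near: d.
  by rewrite ler_wpM2r// le_max lexx orbT.
have H3 : (1 + K) * q ^+ d <= 2^-1.
  by apply: ltW; near: d; apply: cvgr_lt qd _ _; rewrite mulr0 invr_gt0.
have H4 := ler_wpM2l (ltW K0) H2.
have H5 := ler_wpM2r (exprn_ge0 d za0) H3.
by lra.
Unshelve. all: by end_near. Qed.

Lemma cvg_root_card : b d * N d `^ (d%:R^-1) @[d --> \oo] --> L.
Proof.
apply/cvgrPdist_le => e e0.
(* Chosen so that the first-order loss 3 s de L is at most [e]. *)
pose de := Num.min 1 (e / (3 * s * L)).
have de01 : 0 < de <= 1.
  apply/andP; split; last by rewrite /de ge_min lexx.
  by rewrite lt_min ltr01/= divr_gt0// mulr_gt0// mulr_gt0.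
near=> d.
have up : b d * N d `^ (d%:R^-1) < L + e.
  apply: (@le_lt_trans _ _ (expR (s / K * K) * (b d * partition_function (g d) (s / K)))).
    by near: d; exact: root_card_le.
  by near: d; apply: cvgr_lt cvg_upper _ _; rewrite ltrDl.
have low : L * expR (- (3 * s * de)) <= b d * N d `^ (d%:R^-1).
  by near: d; exact: root_card_ge.
have : L - e <= L * expR (- (3 * s * de)).
  apply: (@le_trans _ _ (L * (1 + - (3 * s * de)))); last first.
    by rewrite ler_wpM2l ?(ltW L_gt0)// expR_ge1Dx.
  have : de <= e / (3 * s * L) by rewrite /de ge_min lexx orbT.
  rewrite ler_pdivlMr; last by rewrite mulr_gt0// mulr_gt0.
  by lra.
by rewrite ler_distlC; move: up low; lra.
Unshelve. all: by end_near. Qed.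

End CramerLimit.

(** * Gaussian sums *)

Section GaussSum.
Variable R : realType.

(** The integral of exp(-t^2) over [0, x]. *)
Let G : R -> R := @gauss_integral_proof.integral0_gauss R.

Lemma integrable_gauss_fun (i : interval R) :
  lebesgue_measure.-integrable [set` i] (EFin \o @gauss_fun R).
Proof. by apply: integrableS integrableT_gauss. Qed.

Let G0 : G 0 = 0.
Proof. by rewrite /G /gauss_integral_proof.integral0_gauss set_itv1 Rintegral_set1. Qed.

(** The integrand decreases on the nonnegative reals, so its end values bound it. *)
Let G_bounds x y : 0 <= x -> x <= y ->
  (y - x) * gauss_fun y <= G y - G x <= (y - x) * gauss_fun x.
Proof.
move=> x0 xy; rewrite /G /gauss_integral_proof.integral0_gauss.
rewrite Rintegral_itvB ?bnd_simp//; last exact: integrable_gauss_fun.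
have cstE (c : R) : (y - x) * c = \int[lebesgue_measure]_(t in `]x, y]) c.
  rewrite Rintegral_cst//= lebesgue_measure_itv/= lte_fin.
  case: ltP => [_|yx]; first by rewrite -EFinD/= mulrC.
  by rewrite /= mulr0 (le_anti (introT andP (conj xy yx))) subrr mul0r.
have intc (c : R) : lebesgue_measure.-integrable `]x, y] (EFin \o cst c).
  have : lebesgue_measure.-integrable `[x, y] (EFin \o (cst c : R -> R)).
    apply: continuous_compact_integrable; first exact: segment_compact.
    by apply: continuous_subspaceT; exact: cst_continuous.
  by apply: integrableS => //; exact: subset_itv_oc_cc.
rewrite !cstE; apply/andP; split; apply: le_Rintegral => //.
- exact: intc.
- exact: integrable_gauss_fun.
- move=> t /=; rewrite in_itv/= => /andP[xt ty].
  rewrite /gauss_fun ler_expR lerN2 !expr2.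
  by apply: ler_pM; lra.
- exact: integrable_gauss_fun.
- exact: intc.
- move=> t /=; rewrite in_itv/= => /andP[xt ty].
  rewrite /gauss_fun ler_expR lerN2 !expr2.
  by apply: ler_pM; lra.
Qed.

Let G_cvg : G x @[x --> +oo] --> Num.sqrt pi / 2.
Proof.
have : Num.sqrt (G x ^+ 2) @[x --> +oo] --> Num.sqrt (pi / 4).
  apply: continuous_cvg; first exact: sqrt_continuous.
  exact: gauss_integral_proof.cvg_integral0_gauss_sqr.
have -> : Num.sqrt (pi / 4) = Num.sqrt pi / 2 :> R.
  rewrite sqrtrM ?pi_ge0// sqrtrV// (_ : 4 = 2 ^+ 2); last by rewrite expr2 -natrM.
  by rewrite sqrtr_sqr ger0_norm.
apply: cvg_trans; apply: near_eq_cvg; apply: nearW => x.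
by rewrite sqrtr_sqr ger0_norm// gauss_integral_proof.integral0_gauss_ge0.
Qed.

Let G_le x y : 0 <= x -> x <= y -> G x <= G y.
Proof.
move=> x0 xy; have /andP[H _] := G_bounds x0 xy.
rewrite -subr_ge0; apply: le_trans H.
by rewrite mulr_ge0 ?subr_ge0// gauss_fun_ge0.
Qed.

Let G_le_lim x : 0 <= x -> G x <= Num.sqrt pi / 2.
Proof.
move=> x0; apply: (cvgr_to_ge G_cvg).
by near=> y; apply: G_le => //; near: y; apply: nbhs_pinfty_ge; exact: num_real.
Unshelve. all: by end_near. Qed.

(** The points run with spacing two from 1 - n to n - 1, so one formula serves the even integers (n
    odd) and the odd ones (n even). *)
Definition gauss_sum (n : nat) (t : R) : R :=
  \sum_(i < n) expR (- t * (2 * i%:R + 1 - n%:R) ^+ 2).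

(** The inner points are those for n; the two new ones are the ends n + 1 and -(n + 1). *)
Lemma gauss_sumSS n t :
  gauss_sum n.+2 t = gauss_sum n t + 2 * expR (- t * n.+1%:R ^+ 2).
Proof.
rewrite /gauss_sum big_ord_recl big_ord_recr/= addrCA.
have -> : \sum_(i < n) expR (- t *
      (2 * (lift ord0 (widen_ord (leqnSn n) i))%:R + 1 - n.+2%:R) ^+ 2) =
    \sum_(i < n) expR (- t * (2 * i%:R + 1 - n%:R) ^+ 2) :> R.
  apply: eq_bigr => i _; congr (expR (_ * _ ^+ 2)).
  by rewrite lift0/= -(natr1 i) -(natr1 n.+1) -(natr1 n); ring.
congr (_ + _).
rewrite [RHS]mulr_natl [RHS]mulr2n; congr (expR (_ * _) + expR (_ * _)).
  by rewrite /= -(natr1 n.+1) -(natr1 n); ring.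
by rewrite /bump add1n -(natr1 n.+1) -(natr1 n); ring.
Qed.

(** Induction in steps of two: each new pair is a rectangle of width 2 [h], compared with the
    integral over the next interval for the lower bound and over the previous one for the upper
    bound. *)
Lemma gauss_sum_bounds n (t : R) : 0 <= t ->
  G (Num.sqrt t * n.+1%:R) - Num.sqrt t <= Num.sqrt t * gauss_sum n t <=
  Num.sqrt t + G (Num.sqrt t * n.-1%:R).
Proof.
move=> t0; set h := Num.sqrt t; have h0 : 0 <= h by exact: sqrtr_ge0.
have tE x : expR (- t * x ^+ 2) = gauss_fun (h * x).
  by rewrite /gauss_fun exprMn sqr_sqrtr// mulNr.
have Gle x : 0 <= x -> G x <= x.
  move=> x0; have /andP[_] := G_bounds (lexx 0) x0; rewrite G0 !subr0.
  by move/le_trans; apply; rewrite ler_piMr// gauss_fun_le1.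
have g1 (x : R) : gauss_fun x <= 1 by exact: gauss_fun_le1.
have [m] := ubnP n; elim: m n => // m IH [|[|n]] nm.
- by rewrite /gauss_sum big_ord0 /= mulr1 !mulr0 G0 addr0 subr_le0 Gle.
- rewrite /gauss_sum big_ord1/= mulr0 add0r subrr expr0n/= mulr0 expR0 mulr1.
  rewrite mulr0 G0 addr0 lexx andbT.
  by have := Gle (h * 2); lra.
- have /andP[I1 I2] := IH n (ltnW nm).
  have -> : h * gauss_sum n.+2 t =
      h * gauss_sum n t + 2 * h * gauss_fun (h * n.+1%:R).
    by rewrite gauss_sumSS tE; ring.
  have p k : 0 <= h * k%:R by rewrite mulr_ge0.
  have mono k l : (k <= l)%N -> h * k%:R <= h * l%:R.
    by move=> kl; rewrite ler_wpM2l// ler_nat.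
  have step2 k : h * k.+2%:R - h * k%:R = 2 * h.
    by rewrite -(natr1 k.+1) -(natr1 k); ring.
  have lower (v w x y : R) : x - h <= w -> y - x <= v -> y - h <= w + v by lra.
  have upper (v w x y : R) : w <= h + x -> v <= y - x -> w + v <= h + y by lra.
  apply/andP; split.
    apply: (lower _ _ _ _ I1); rewrite -(step2 n.+1).
    by have /andP[] := G_bounds (p n.+1) (mono n.+1 n.+3 (leqW (leqnSn _))).
  (* For n = 0 the truncated predecessor is 0 instead of -1, so the previous interval has only width
     [h]; the other half of the pair is bounded by [h]. *)
  case: n {nm I1} I2 => [_|n I2].
    have -> : gauss_sum 0 t = 0 by rewrite /gauss_sum big_ord0.
    have /andP[+ _] := G_bounds (lexx 0) (p 1).
    have := ler_wpM2l h0 (g1 (h * 1)).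
    rewrite G0 !subr0 mulr0 !mulr1 /=.
    by move: (gauss_fun h) (G h) => x y; lra.
  apply: (upper _ _ _ _ I2); rewrite -(step2 n).
  by have /andP[] := G_bounds (p n) (mono n n.+2 (leqW (leqnSn _))).
Qed.

(** The mesh tends to 0, which kills the error terms, while the range of summation exhausts the
    line. *)
Lemma cvg_gauss_sum (n : nat -> nat) (t : nat -> R) :
  (forall d, 0 <= t d) -> t d @[d --> \oo] --> (0 : R) ->
  Num.sqrt (t d) * (n d)%:R @[d --> \oo] --> +oo ->
  Num.sqrt (t d) * gauss_sum (n d) (t d) @[d --> \oo] --> Num.sqrt pi / 2.
Proof.
move=> t0 ct cn.
have ch : Num.sqrt (t d) @[d --> \oo] --> (0 : R).
  rewrite -(@sqrtr0 R).
  exact: (cvg_comp _ _ ct (@sqrt_continuous R 0)).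
have cn1 : Num.sqrt (t d) * (n d).+1%:R @[d --> \oo] --> +oo.
  apply: (ger_cvgy _ cn); apply: nearW => d.
  by rewrite ler_wpM2l ?sqrtr_ge0// ler_nat.
apply: (@squeeze_cvgr _ _ _ _ (fun d => G (Num.sqrt (t d) * (n d).+1%:R) - Num.sqrt (t d))
  (fun d => Num.sqrt (t d) + Num.sqrt pi / 2)).
- apply: nearW => d; have /andP[-> H] := gauss_sum_bounds (n d) (t0 d).
  rewrite /=; apply: (le_trans H); rewrite lerD2l; apply: G_le_lim.
  by apply: mulr_ge0 => //; exact: sqrtr_ge0.
- rewrite -[X in _ --> X]subr0; apply: cvgB => //.
  exact: (cvg_comp _ _ cn1 G_cvg).
- by rewrite -[X in _ --> X]add0r; apply: cvgD => //; exact: cvg_cst.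
Qed.

End GaussSum.

(** * Additive quadruples of integers *)

Lemma card_fset_bij (S : finType) (V : choiceType) (P : pred S) (A : {fset V})
    (f : S -> V) :
  injective f -> (forall x, (f x \in A) = P x) ->
  (forall y, y \in A -> exists x, f x = y) -> #|` A| = #|P|.
Proof.
move=> finj fA fsurj.
have -> : A = [fset f x | x in P].
  apply/fsetP => y; apply/idP/imfsetP => [yA|[x xP ->]]; last by rewrite fA.
  have [x xy] := fsurj y yA.
  by exists x => //; rewrite -[_ \in _]/(P x) -fA xy.
by rewrite card_imfset//= cardE.
Qed.

Lemma ord_of_int (n : nat) (x : int) : 0 <= x < n%:Z -> exists i : 'I_n, i%:Z = x.
Proof.
move=> /andP[x0 xn].
have lt : (`|x| < n)%N by lia.
by exists (Ordinal lt) => /=; lia.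
Qed.

(* All quadruples [a] with a_1 + a_2 = a_3 + a_4, through u = a_1 + a_2, v = a_1 - a_2 and
   w = a_3 - a_4, which have the same parity and satisfy 2 |a|^2 = 2 u^2 + v^2 + w^2: an
   index i < n stands for 2 i + 1 - n, so that u, v, w are even for odd n and odd for even
   n. *)
Definition quadruple (n : nat) (t : 'I_n * 'I_n * 'I_n) (m : 'I_4) : int :=
  nth 0 [:: t.1.1%:Z + t.1.2%:Z + 1 - n%:Z; t.1.1%:Z - t.1.2%:Z;
            t.1.1%:Z + t.2%:Z + 1 - n%:Z; t.1.1%:Z - t.2%:Z] m.

(** The left summand gives the even u, v, w in [-2M, 2M], the right one the odd ones in
    [-2M-1, 2M+1]. *)
Definition quad_index (M : nat) : finType :=
  (('I_M.*2.+1 * 'I_M.*2.+1 * 'I_M.*2.+1) +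
   ('I_M.*2.+2 * 'I_M.*2.+2 * 'I_M.*2.+2))%type.

Definition quad (M : nat) (t : quad_index M) : 'I_4 -> int :=
  match t with inl u => quadruple u | inr u => quadruple u end.

Definition q0 : 'I_4 := inord 0. Definition q1 : 'I_4 := inord 1.
Definition q2 : 'I_4 := inord 2. Definition q3 : 'I_4 := inord 3.

Lemma ord4P (P : 'I_4 -> Prop) : P q0 -> P q1 -> P q2 -> P q3 -> forall j, P j.
Proof.
move=> P0 P1 P2 P3 [[|[|[|[|//]]]] lt].
- by rewrite (_ : Ordinal lt = q0)//; apply/val_inj; rewrite /= inordK.
- by rewrite (_ : Ordinal lt = q1)//; apply/val_inj; rewrite /= inordK.
- by rewrite (_ : Ordinal lt = q2)//; apply/val_inj; rewrite /= inordK.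
- by rewrite (_ : Ordinal lt = q3)//; apply/val_inj; rewrite /= inordK.
Qed.

Lemma quadrupleE n (t : 'I_n * 'I_n * 'I_n) :
  (quadruple t q0 = t.1.1%:Z + t.1.2%:Z + 1 - n%:Z) *
  (quadruple t q1 = t.1.1%:Z - t.1.2%:Z) *
  (quadruple t q2 = t.1.1%:Z + t.2%:Z + 1 - n%:Z) *
  (quadruple t q3 = t.1.1%:Z - t.2%:Z).
Proof. by rewrite /quadruple !inordK. Qed.

Lemma quad_sum M (t : quad_index M) : quad t q0 + quad t q1 = quad t q2 + quad t q3.
Proof. by case: t => u; rewrite /quad !quadrupleE; lia. Qed.

Lemma quad_inj M (t u : quad_index M) : quad t =1 quad u -> t = u.
Proof.
move=> tu; move: (tu q0) (tu q1) (tu q2) (tu q3) => {tu}.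
(* The mixed cases fail by parity: the sum of the first two entries is even on the left summand, odd
   on the right one. *)
case: t u => [[[i j] l]|[[i j] l]] [[[i' j'] l']|[[i' j'] l']];
  rewrite /quad !quadrupleE /= => H0 H1 H2 H3; try (exfalso; lia).
- have -> : i = i' by apply/val_inj => /=; lia.
  have -> : j = j' by apply/val_inj => /=; lia.
  by have -> : l = l' by apply/val_inj => /=; lia.
- have -> : i = i' by apply/val_inj => /=; lia.
  have -> : j = j' by apply/val_inj => /=; lia.
  by have -> : l = l' by apply/val_inj => /=; lia.
Qed.

Lemma quad_surj M (a1 a2 a3 a4 : int) : a1 + a2 = a3 + a4 ->
  `|a1| <= M%:Z -> `|a2| <= M%:Z -> `|a3| <= M%:Z -> `|a4| <= M%:Z ->
  exists t : quad_index M,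
    [/\ quad t q0 = a1, quad t q1 = a2, quad t q2 = a3 & quad t q3 = a4].
Proof.
move=> sum b1 b2 b3 b4.
(* The parity of a1 + a2 selects the summand; [i] is then the index of a1 + a2, and j = i - a2, l =
   i - a4. *)
have [s [sE|sE]] : exists s : int, a1 + a2 = s + s \/ a1 + a2 = s + s + 1.
  by exists ((a1 + a2) %/ 2)%Z; lia.
- have [i iE] := @ord_of_int M.*2.+1 (s + M%:Z) ltac:(lia).
  have [j jE] := @ord_of_int M.*2.+1 (s + M%:Z - a2) ltac:(lia).
  have [l lE] := @ord_of_int M.*2.+1 (s + M%:Z - a4) ltac:(lia).
  by exists (inl (i, j, l)); rewrite /quad !quadrupleE /= iE jE lE; split; lia.
- have [i iE] := @ord_of_int M.*2.+2 (s + M%:Z + 1) ltac:(lia).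
  have [j jE] := @ord_of_int M.*2.+2 (s + M%:Z + 1 - a2) ltac:(lia).
  have [l lE] := @ord_of_int M.*2.+2 (s + M%:Z + 1 - a4) ltac:(lia).
  by exists (inr (i, j, l)); rewrite /quad !quadrupleE /= iE jE lE; split; lia.
Qed.

(** * Costs, their partition functions and symmetries, and the two counts *)

Section Costs.
Variable R : realType.
Implicit Types (h a : R) (M : nat).

Definition interval_cost h M (j : 'I_1) (i : 'I_M.*2.+1) : R :=
  h * (i%:Z - M%:Z)%:~R ^+ 2.

Definition quad_cost h M (j : 'I_4) (t : quad_index M) : R :=
  h * (quad t j)%:~R ^+ 2.

Lemma interval_cost_ge0 h M j t : 0 <= h -> 0 <= @interval_cost h M j t.
Proof. by move=> h0; rewrite mulr_ge0// sqr_ge0. Qed.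

Lemma quad_cost_ge0 h M j t : 0 <= h -> 0 <= @quad_cost h M j t.
Proof. by move=> h0; rewrite mulr_ge0// sqr_ge0. Qed.

(** The points of [gauss_sum] are twice the integers [i - M], hence the division by 4. *)
Lemma partition_interval h M a :
  partition_function (@interval_cost h M) a = gauss_sum M.*2.+1 (a * h / 4).
Proof.
apply: eq_bigr => i _; congr expR.
rewrite /total_cost big_ord1 /interval_cost intrB -[(i%:Z)%:~R]/(i%:R) -[(M%:Z)%:~R]/(M%:R).
have -> : M.*2.+1%:R = 2 * M%:R + 1 :> R by rewrite -natr1 -mul2n natrM.
by field.
Qed.

Lemma sum_ord4 (f : 'I_4 -> R) : \sum_j f j = f q0 + f q1 + f q2 + f q3.
Proof.
rewrite !big_ord_recl big_ord0 addr0 !addrA.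
congr (f _ + f _ + f _ + f _); apply/val_inj;
  by rewrite /q0 /q1 /q2 /q3 [in RHS]/= inordK.
Qed.

Lemma sum_triple n (F1 F2 F3 : 'I_n -> R) :
  \sum_(t : 'I_n * 'I_n * 'I_n) F1 t.1.1 * F2 t.1.2 * F3 t.2 =
  (\sum_i F1 i) * (\sum_i F2 i) * (\sum_i F3 i).
Proof.
rewrite -(pair_bigA _ (fun u l => F1 u.1 * F2 u.2 * F3 l))/=.
rewrite -(pair_bigA _ (fun i j => \sum_l F1 i * F2 j * F3 l))/=.
rewrite !mulr_suml; apply: eq_bigr => i _.
rewrite [F1 i * _]mulr_sumr mulr_suml; apply: eq_bigr => j _.
by rewrite mulr_sumr.
Qed.

(** In the coordinates u, v, w one has |a|^2 = u^2 + v^2 / 2 + w^2 / 2, so the sum splits into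
    three. *)
Lemma sum_quadruple h a n :
  \sum_(u : 'I_n * 'I_n * 'I_n)
    expR (- a * \sum_j h * (quadruple u j)%:~R ^+ 2) =
  gauss_sum n (a * h) * gauss_sum n (a * h / 2) ^+ 2.
Proof.
rewrite expr2 mulrA -sum_triple; apply: eq_bigr => -[[i j] l] _.
rewrite -!expRD; congr expR.
rewrite sum_ord4 !quadrupleE/= !(intrB, intrD).
rewrite -[(i%:Z)%:~R]/(i%:R) -[(j%:Z)%:~R]/(j%:R) -[(l%:Z)%:~R]/(l%:R) -[(n%:Z)%:~R]/(n%:R).
by field.
Qed.

Lemma partition_quad h M a :
  partition_function (@quad_cost h M) a =
  gauss_sum M.*2.+1 (a * h) * gauss_sum M.*2.+1 (a * h / 2) ^+ 2 +
  gauss_sum M.*2.+2 (a * h) * gauss_sum M.*2.+2 (a * h / 2) ^+ 2.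
Proof. by rewrite /partition_function big_sumType/= -!sum_quadruple. Qed.

(** The reversals negate v, resp. w, and so exchange a_1 with a_2, resp. a_3 with a_4; the swap of v
    and w exchanges the two pairs. *)
Definition triple_rev2 n (u : 'I_n * 'I_n * 'I_n) : 'I_n * 'I_n * 'I_n :=
  (u.1.1, rev_ord u.1.2, u.2).
Definition triple_rev3 n (u : 'I_n * 'I_n * 'I_n) : 'I_n * 'I_n * 'I_n :=
  (u.1.1, u.1.2, rev_ord u.2).
Definition triple_swap n (u : 'I_n * 'I_n * 'I_n) : 'I_n * 'I_n * 'I_n :=
  (u.1.1, u.2, u.1.2).

Definition quad_map M (f : forall n, 'I_n * 'I_n * 'I_n -> 'I_n * 'I_n * 'I_n)
    (t : quad_index M) : quad_index M :=
  match t with inl u => inl (f _ u) | inr u => inr (f _ u) end.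

(** Reindexing by [f] permutes the four entries and leaves the total cost unchanged. *)
Lemma sum_quad_cost_map h M a (f : forall n, 'I_n * 'I_n * 'I_n -> 'I_n * 'I_n * 'I_n)
    (s : 'I_4 -> 'I_4) j :
  (forall n, involutive (f n)) -> involutive s ->
  (forall n u i, quadruple (f n u) i = quadruple u (s i)) ->
  \sum_t quad_cost h (s j) t * expR (- a * total_cost (@quad_cost h M) t) =
  \sum_t quad_cost h j t * expR (- a * total_cost (@quad_cost h M) t).
Proof.
move=> finv sinv fs.
have qinv : involutive (@quad_map M f) by case=> u /=; rewrite finv.
have qs t i : quad (quad_map f t) i = quad t (s i) by case: t => u /=.
rewrite [RHS](reindex_inj (inv_inj qinv))/=; apply: eq_bigr => t _.
rewrite /total_cost /quad_cost qs (reindex_inj (inv_inj sinv))/=.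
by under [in RHS]eq_bigr do rewrite qs.
Qed.

(** The three involutions act transitively on the four entries. *)
Lemma quad_cost_sym h M a j :
  \sum_t quad_cost h j t * expR (- a * total_cost (@quad_cost h M) t) =
  \sum_t quad_cost h ord0 t * expR (- a * total_cost (@quad_cost h M) t).
Proof.
have -> : ord0 = q0 by apply/val_inj; rewrite /q0 [in RHS]/= inordK.
have rev_intE n (i : 'I_n) : (rev_ord i)%:Z = n%:Z - 1 - i%:Z.
  by rewrite /=; have := ltn_ord i; lia.
have qE : (q0 == q1 = false) * (q0 == q2 = false) * (q0 == q3 = false) *
  (q1 == q2 = false) * (q1 == q3 = false) * (q2 == q3 = false).
  by do !split; rewrite -val_eqE /= !inordK.
have qE' : (q1 == q0 = false) * (q2 == q0 = false) * (q3 == q0 = false) *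
  (q2 == q1 = false) * (q3 == q1 = false) * (q3 == q2 = false).
  by do !split; rewrite -val_eqE /= !inordK.
have E1 : \sum_t quad_cost h q1 t * expR (- a * total_cost (@quad_cost h M) t) =
  \sum_t quad_cost h q0 t * expR (- a * total_cost (@quad_cost h M) t).
  rewrite -(@sum_quad_cost_map h M a triple_rev2
    (fun m => if m == q0 then q1 else if m == q1 then q0 else m) q0).
  - by rewrite !(eqxx, qE, qE').
  - by move=> n [[i j'] l]; rewrite /triple_rev2 /= rev_ordK.
  - by apply: ord4P; rewrite !(eqxx, qE, qE').
  - move=> n [[i j'] l]; apply: ord4P;
      rewrite !(eqxx, qE, qE') !quadrupleE /triple_rev2 /= ?rev_intE; lia.
have E2 : \sum_t quad_cost h q2 t * expR (- a * total_cost (@quad_cost h M) t) =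
  \sum_t quad_cost h q0 t * expR (- a * total_cost (@quad_cost h M) t).
  rewrite -(@sum_quad_cost_map h M a triple_swap
    (fun m => if m == q0 then q2 else if m == q1 then q3
      else if m == q2 then q0 else q1) q0).
  - by rewrite !(eqxx, qE, qE').
  - by move=> n [[i j'] l].
  - by apply: ord4P; rewrite !(eqxx, qE, qE').
  - move=> n [[i j'] l]; apply: ord4P;
      rewrite !(eqxx, qE, qE') !quadrupleE /triple_swap /= ?rev_intE; lia.
have E3 : \sum_t quad_cost h q3 t * expR (- a * total_cost (@quad_cost h M) t) =
  \sum_t quad_cost h q2 t * expR (- a * total_cost (@quad_cost h M) t).
  rewrite -(@sum_quad_cost_map h M a triple_rev3
    (fun m => if m == q2 then q3 else if m == q3 then q2 else m) q2).
  - by rewrite !(eqxx, qE, qE').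
  - by move=> n [[i j'] l]; rewrite /triple_rev3 /= rev_ordK.
  - by apply: ord4P; rewrite !(eqxx, qE, qE').
  - move=> n [[i j'] l]; apply: ord4P;
      rewrite !(eqxx, qE, qE') !quadrupleE /triple_rev3 /= ?rev_intE; lia.
by move: j; apply: ord4P => //; rewrite E3.
Qed.

Lemma mem_lattice_ball_row d (r : R) (x : 'I_d -> int) : (0 < d)%N -> 0 < r ->
  (\row_i x i \in lattice_ball d r) =
  (\sum_i d%:R / r ^+ 2 * (x i)%:~R ^+ 2 <= d%:R).
Proof.
move=> d0 r0; rewrite mem_lattice_ball /euclidean_norm.
under eq_bigr do rewrite !mxE.
rewrite -mulr_sumr; set S : R := \sum_i _.
have S0 : 0 <= S by apply: sumr_ge0 => i _; exact: sqr_ge0.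
have dR : 0 < d%:R :> R by rewrite ltr0n.
have -> : d%:R / r ^+ 2 * S = S / r ^+ 2 * d%:R by ring.
rewrite -[X in _ = (_ <= X)]mul1r ler_pM2r// ler_pdivrMr ?exprn_gt0// mul1r.
by rewrite -[in LHS](ger0_norm (ltW r0)) -sqrtr_sqr ler_sqrt// sqr_ge0.
Qed.

Lemma lattice_ball_coord_le d (r : R) M (z : 'rV[int]_d) i :
  `|r| <= M%:R -> z \in lattice_ball d r -> `|z ord0 i| <= M%:Z.
Proof.
move=> rM; rewrite mem_lattice_ball => zr.
rewrite -(ler_int R) intr_norm -[(M%:Z)%:~R]/(M%:R).
apply: le_trans rM; apply: le_trans (le_trans zr (ler_norm r)).
rewrite /euclidean_norm -sqrtr_sqr ler_wsqrtr//.
by rewrite (bigD1 i)//= mxE lerDl sumr_ge0// => j _; exact: sqr_ge0.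
Qed.

(** Truncating the coordinates at [M] loses no point, since they are bounded by [r]. *)
Lemma card_lattice_ball d (r : R) M : (0 < d)%N -> 0 < r -> `|r| <= M%:R ->
  #|` lattice_ball d r| = #|admissible (@interval_cost (d%:R / r ^+ 2) M) d|.
Proof.
move=> d0 r0 rM.
apply: (@card_fset_bij _ _ _ _
  (fun x : {ffun 'I_d -> 'I_M.*2.+1} => \row_i ((x i)%:Z - M%:Z))).
- move=> x y /rowP xy; apply/ffunP => i; have := xy i; rewrite !mxE => H.
  by apply/val_inj => /=; lia.
- move=> x; rewrite mem_lattice_ball_row//.
  by apply/idP/forallP => [H j|/(_ ord0)].
- move=> z zb.
  have /fin_all_exists [x xE] : forall i, exists u : 'I_M.*2.+1, u%:Z = z ord0 i + M%:Z.
    move=> i; apply: ord_of_int.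
    by move: (z ord0 i) (lattice_ball_coord_le i rM zb) => w; lia.
  by exists [ffun i => x i]; apply/rowP => i; rewrite !mxE ffunE xE addrK.
Qed.

(** Transposition: four vectors become a word of d quadruples. The equation is built into [quad],
    and the four memberships are the four constraints. *)
Lemma additive_energy_lattice_ball d (r : R) M : (0 < d)%N -> 0 < r -> `|r| <= M%:R ->
  additive_energy (lattice_ball d r) =
  #|admissible (@quad_cost (d%:R / r ^+ 2) M) d|.
Proof.
move=> d0 r0 rM.
pose f (x : {ffun 'I_d -> quad_index M}) := let c j := \row_i quad (x i) j in
  ((c q0, c q1), (c q2, c q3)).
apply: (@card_fset_bij _ _ _ _ f).
- move=> x y [/rowP e0 /rowP e1 /rowP e2 /rowP e3]; apply/ffunP => i.
  apply: quad_inj; apply: ord4P.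
  + by have := e0 i; rewrite !mxE.
  + by have := e1 i; rewrite !mxE.
  + by have := e2 i; rewrite !mxE.
  + by have := e3 i; rewrite !mxE.
- move=> x; rewrite !inE/= !mem_lattice_ball_row//.
  have -> : \row_i quad (x i) q0 + \row_i quad (x i) q1 ==
      \row_i quad (x i) q2 + \row_i quad (x i) q3.
    by apply/eqP/rowP => i; rewrite !mxE quad_sum.
  rewrite andbT; apply/idP/forallP => [/andP[/andP[H0 H1] /andP[H2 H3]]|H].
    exact: ord4P.
  by rewrite (H q0) (H q1) (H q2) (H q3).
- move=> [[z1 z2] [z3 z4]]; rewrite !inE/=.
  move=> /andP[/andP[/andP[b1 b2] /andP[b3 b4]] /eqP/rowP sum].
  have /fin_all_exists [x xE] : forall i, exists t : quad_index M,
      [/\ quad t q0 = z1 ord0 i, quad t q1 = z2 ord0 i,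
          quad t q2 = z3 ord0 i & quad t q3 = z4 ord0 i].
    move=> i; apply: quad_surj; first by have := sum i; rewrite !mxE.
    + exact: lattice_ball_coord_le rM b1.
    + exact: lattice_ball_coord_le rM b2.
    + exact: lattice_ball_coord_le rM b3.
    + exact: lattice_ball_coord_le rM b4.
  exists [ffun i => x i]; rewrite /f.
  congr (_, _, (_, _)); apply/rowP => i; rewrite !mxE ffunE.
  all: by case: (xE i).
Qed.

End Costs.

(** * Lattice balls *)

Lemma sqrt_expR_ln (R : realType) (x : R) : 0 < x -> Num.sqrt x = expR (2^-1 * ln x).
Proof. by move=> x0; rewrite -powR12_sqrt ?ltW// /powR gt_eqF. Qed.

Section Asymptotics.
Variables (R : realType) (r : nat -> R).
Hypothesis r_gt0 : forall d : nat, (0 < d)%N -> 0 < r d.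
Hypothesis r_cvg : r d / Num.sqrt d%:R @[d --> \oo] --> +oo.

Let h d : R := d%:R / r d ^+ 2.
Let M d : nat := Num.bound `|r d|.

Let h_ge0 d : 0 <= h d. Proof. by rewrite divr_ge0// sqr_ge0. Qed.

Let norm_r_le d : `|r d| <= (M d)%:R.
Proof. exact/ltW/archi_boundP. Qed.

Let h_cvg : h d @[d --> \oo] --> (0 : R).
Proof.
have H : (r d / Num.sqrt d%:R)^-1 @[d --> \oo] --> (0 : R).
  rewrite gtr0_cvgV0//; exists 1%N => // d /= d1.
  by rewrite divr_gt0 ?r_gt0// sqrtr_gt0 ltr0n.
have H2 := cvgM (FF := eventually_filter) H H; rewrite mulr0 in H2.
apply: cvg_trans H2; apply: near_eq_cvg.
apply: nearW => d.
by rewrite /= invf_div -expr2 expr_div_n sqr_sqrtr.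
Qed.

Lemma cvg_sqrt_gauss_sum (n : nat -> nat) (c : R) : 0 < c ->
  (forall d, M d <= n d)%N ->
  Num.sqrt (h d) * gauss_sum (n d) (c * h d) @[d --> \oo] -->
  Num.sqrt pi / 2 * expR (- (2^-1 * ln c)).
Proof.
move=> c0 Mn.
have sc0 : 0 < Num.sqrt c by rewrite sqrtr_gt0.
have ct : c * h d @[d --> \oo] --> (0 : R).
  by rewrite -(mulr0 c); exact: cvgMl_tmp.
(* As n >= r, this is at least the square root of c d. *)
have cn : Num.sqrt (c * h d) * (n d)%:R @[d --> \oo] --> +oo.
  apply/cvgryPge => A; near=> d.
  have d0 : (0 < d)%N by near: d; exact: nbhs_infty_gt.
  have rn : r d <= (n d)%:R.
    apply: (le_trans (ler_norm _)); apply: (le_trans (norm_r_le d)).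
    by rewrite ler_nat.
  have dA : (A / Num.sqrt c) ^+ 2 <= d%:R by near: d; exact: nbhs_infty_ger.
  have hE : Num.sqrt (h d) = Num.sqrt d%:R / r d.
    by rewrite sqrtrM// sqrtrV ?sqr_ge0// sqrtr_sqr ger0_norm// ltW// r_gt0.
  rewrite (sqrtrM _ (ltW c0)) hE.
  apply: (@le_trans _ _ (Num.sqrt c * Num.sqrt d%:R)).
    rewrite mulrC -ler_pdivrMr//.
    by apply: (le_trans (ler_norm _)); rewrite -sqrtr_sqr ler_wsqrtr.
  rewrite -!mulrA ler_wpM2l ?(ltW sc0)// ler_peMr ?sqrtr_ge0//.
  by rewrite mulrC ler_pdivlMr ?r_gt0// mul1r.
have C : (Num.sqrt c)^-1 * (Num.sqrt (c * h d) * gauss_sum (n d) (c * h d))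
    @[d --> \oo] --> (Num.sqrt c)^-1 * (Num.sqrt pi / 2).
  apply: cvgMl_tmp; apply: cvg_gauss_sum => // d.
  by rewrite mulr_ge0// ltW.
rewrite mulrC expRN -(sqrt_expR_ln c0); apply: cvg_trans C.
apply: near_eq_cvg; apply: nearW => d /=.
by rewrite (sqrtrM _ (ltW c0)) mulrA mulKf// gt_eqF.
Unshelve. all: by end_near. Qed.

(** The case K = 1, s = 1/2. *)
Lemma cvg_root_card_ball :
  Num.sqrt (h d) * #|` lattice_ball d (r d)|%:R `^ (d%:R^-1) @[d --> \oo] -->
  Num.sqrt pi * expR (2^-1 * (1 + ln 2)).
Proof.
have sqrt_pi : 0 < Num.sqrt pi :> R by rewrite sqrtr_gt0 pi_gt0.
have cvg_part (a : R) : 0 < a ->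
    Num.sqrt (h d) * partition_function (@interval_cost R (h d) (M d)) a
      @[d --> \oo] --> Num.sqrt pi * expR (- (2^-1 * ln a)).
  move=> a0.
  have a4 : 0 < a / 4 by rewrite divr_gt0.
  have Mn d : (M d <= (M d).*2.+1)%N by lia.
  have -> : Num.sqrt pi * expR (- (2^-1 * ln a)) =
      Num.sqrt pi / 2 * expR (- (2^-1 * ln (a / 4))) :> R.
    have -> : ln (a / 4) = ln a - 2 * ln 2.
      rewrite lnM ?posrE ?invr_gt0// lnV ?posrE//; congr (_ - _).
      by rewrite (_ : 4 = 2 ^+ 2) ?lnXn// ?mulr_natl// expr2 -natrM.
    rewrite (_ : - (2^-1 * (ln a - 2 * ln 2)) = - (2^-1 * ln a) + ln 2); last by field.
    by rewrite expRD lnK ?posrE//; field.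
  apply: cvg_trans (cvg_sqrt_gauss_sum a4 Mn).
  apply: near_eq_cvg; apply: nearW => d /=.
  by rewrite partition_interval mulrAC.
have sym d (a : R) j :
    \sum_t interval_cost (h d) j t *
      expR (- a * total_cost (@interval_cost R (h d) (M d)) t) =
    \sum_t interval_cost (h d) ord0 t *
      expR (- a * total_cost (@interval_cost R (h d) (M d)) t).
  by rewrite ord1.
have half0 : 0 < 2^-1 :> R by rewrite invr_gt0.
have H := @cvg_root_card R 0 _ (fun d => @interval_cost R (h d) (M d)) _ _ _
  (fun d j t => interval_cost_ge0 j t (h_ge0 d)) sym
  (fun d => sqrtr_ge0 (h d)) sqrt_pi half0 cvg_part.
rewrite invrK mul1r in H; apply: cvg_trans H; apply: near_eq_cvg; near=> d.
have d0 : (0 < d)%N by near: d; exact: nbhs_infty_gt.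
by rewrite (@card_lattice_ball R d (r d) (M d))// r_gt0.
Unshelve. all: by end_near. Qed.

(** The case K = 4, s = 3/2, whence K / s = 8/3. *)
Lemma cvg_root_energy :
  Num.sqrt (h d) ^+ 3 *
    (additive_energy (lattice_ball d (r d)))%:R `^ (d%:R^-1) @[d --> \oo] -->
  Num.sqrt pi ^+ 3 / 2 * expR (3 / 2 * (1 + ln (8 / 3))).
Proof.
have sqrt_pi : 0 < Num.sqrt pi :> R by rewrite sqrtr_gt0 pi_gt0.
have c0 : 0 < Num.sqrt pi ^+ 3 / 2 :> R by rewrite divr_gt0// exprn_gt0.
have cvg_part (a : R) : 0 < a ->
    Num.sqrt (h d) ^+ 3 * partition_function (@quad_cost R (h d) (M d)) a
      @[d --> \oo] --> Num.sqrt pi ^+ 3 / 2 * expR (- (3 / 2 * ln a)).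
  move=> a0.
  have a2 : 0 < a / 2 by rewrite divr_gt0.
  have Mn1 d : (M d <= (M d).*2.+1)%N by lia.
  have Mn2 d : (M d <= (M d).*2.+2)%N by lia.
  have C1 := cvg_sqrt_gauss_sum a0 Mn1.
  have C2 := cvg_sqrt_gauss_sum a2 Mn1.
  have C3 := cvg_sqrt_gauss_sum a0 Mn2.
  have C4 := cvg_sqrt_gauss_sum a2 Mn2.
  pose l1 : R := Num.sqrt pi / 2 * expR (- (2^-1 * ln a)).
  pose l2 : R := Num.sqrt pi / 2 * expR (- (2^-1 * ln (a / 2))).
  (* Both parity classes have the same limit: [l1] comes from u, each [l2] from v or w. *)
  have -> : Num.sqrt pi ^+ 3 / 2 * expR (- (3 / 2 * ln a)) =
      l1 * (l2 * l2) + l1 * (l2 * l2).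
    rewrite /l1 /l2; have -> : ln (a / 2) = ln a - ln 2.
      by rewrite lnM ?posrE ?invr_gt0// lnV ?posrE.
    have e2 : expR (- (2^-1 * (ln a - ln 2))) * expR (- (2^-1 * (ln a - ln 2))) =
      2 * expR (- ln a).
      rewrite -expRD (_ : _ + _ = ln 2 - ln a); last by field.
      by rewrite expRD lnK ?posrE.
    have e3 : expR (- (3 / 2 * ln a)) = expR (- (2^-1 * ln a)) * expR (- ln a).
      by rewrite -expRD; congr expR; field.
    have xy (x y : R) : x * y * (x * y) = x ^+ 2 * (y * y) by ring.
    by rewrite e3 xy e2; field.
  apply: cvg_trans (cvgD (FF := eventually_filter)
    (cvgM C1 (cvgM C2 C2)) (cvgM C3 (cvgM C4 C4))).
  apply: near_eq_cvg; apply: nearW => d /=.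
  rewrite partition_quad fctE /= (mulrAC a 2^-1); ring.
have s0 : 0 < 3 / 2 :> R by rewrite divr_gt0.
have H := @cvg_root_card R 3 _ (fun d => @quad_cost R (h d) (M d)) _ _ _
  (fun d j t => quad_cost_ge0 j t (h_ge0 d)) (fun d => @quad_cost_sym R (h d) (M d))
  (fun d => exprn_ge0 3 (sqrtr_ge0 (h d))) c0 s0 cvg_part.
rewrite (_ : 4 / (3 / 2) = 8 / 3) in H; last by field.
apply: cvg_trans H; apply: near_eq_cvg; near=> d.
have d0 : (0 < d)%N by near: d; exact: nbhs_infty_gt.
by rewrite (@additive_energy_lattice_ball R d (r d) (M d))// r_gt0.
Unshelve. all: by end_near. Qed.

End Asymptotics.

(** * The limit of the normalised energy *)

Theorem theorem1p1 (R : realType) (r : nat -> R)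
    (r_gt0 : forall d : nat, (0 < d)%N -> 0 < r d)
    (r_cvg : r d / Num.sqrt d%:R @[d --> \oo] --> +oo) :
  ((additive_energy (lattice_ball d (r d)))%:R
     / #|` lattice_ball d (r d)|%:R ^+ 3) `^ (d%:R^-1) @[d --> \oo]
  --> (4 * Num.sqrt 3 / 9 : R).
Proof.
have ball := cvg_root_card_ball r_gt0 r_cvg.
have energy := cvg_root_energy r_gt0 r_cvg.
set p : R := Num.sqrt pi in ball energy; set e : R := expR (2^-1 * (1 + ln 2)) in ball.
have p0 : p != 0 by rewrite gt_eqF// sqrtr_gt0 pi_gt0.
have e0 : e != 0 by rewrite gt_eqF// expR_gt0.
have s3 : 0 < Num.sqrt 3 :> R by rewrite sqrtr_gt0.
have ln8 : ln 8 = 3 * ln 2 :> R.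
  by rewrite (_ : 8 = 2 ^+ 3) ?lnXn// ?mulr_natl// !exprS expr0 mulr1 -!natrM.
(* Splits off the cube of the ball constant [e], which cancels in the quotient and leaves 8 /
   3^(3/2). *)
have energyE : expR (3 / 2 * (1 + ln (8 / 3))) = e ^+ 3 * (8 / (3 * Num.sqrt 3)).
  have -> : 3 / 2 * (1 + ln (8 / 3)) =
      3%:R * (2^-1 * (1 + ln 2)) + (ln 8 - (ln 3 + 2^-1 * ln 3)) :> R.
    by rewrite ln_div ?posrE// ln8; field.
  rewrite expRD expRM_natl expRD expRN expRD !lnK ?posrE//.
  by rewrite -sqrt_expR_ln.
have -> : 4 * Num.sqrt 3 / 9 =
    p ^+ 3 / 2 * expR (3 / 2 * (1 + ln (8 / 3))) / (p * e * (p * e * (p * e))).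
  rewrite energyE.
  have -> : p ^+ 3 / 2 * (e ^+ 3 * (8 / (3 * Num.sqrt 3))) / (p * e * (p * e * (p * e))) =
     4 / (3 * Num.sqrt 3).
    by field; rewrite p0 e0 gt_eqF.
  have s3n : 3 * Num.sqrt 3 != 0 :> R by rewrite gt_eqF// mulr_gt0.
  have n9 : 9 != 0 :> R by rewrite pnatr_eq0.
  apply/eqP; rewrite (eqr_div _ _ n9 s3n); apply/eqP.
  transitivity (12 * Num.sqrt 3 ^+ 2 : R); first by ring.
  by rewrite sqr_sqrtr//; ring.
have pe0 : p * e != 0 by rewrite mulf_neq0.
(* The scale enters numerator and denominator to the same third power and cancels. *)
pose u d := Num.sqrt (d%:R / r d ^+ 2) * #|` lattice_ball d (r d)|%:R `^ (d%:R^-1).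
pose v d := Num.sqrt (d%:R / r d ^+ 2) ^+ 3 *
  (additive_energy (lattice_ball d (r d)))%:R `^ (d%:R^-1).
have lim : v d / (u d * (u d * u d)) @[d --> \oo] -->
    p ^+ 3 / 2 * expR (3 / 2 * (1 + ln (8 / 3))) / (p * e * (p * e * (p * e))).
  apply: cvgM; first exact: energy.
  apply: cvgV; first by rewrite !mulf_neq0.
  by do 2 (apply: cvgM; first exact: ball).
apply: cvg_trans lim.
rewrite /u /v.
apply: near_eq_cvg; near=> d => /=.
have d0 : (0 < d)%N by near: d; exact: nbhs_infty_gt.
have h0 : 0 < Num.sqrt (d%:R / r d ^+ 2).
  by rewrite sqrtr_gt0 divr_gt0 ?ltr0n// exprn_gt0// r_gt0.
set E : R := (additive_energy _)%:R; set N : R := #|` _|%:R.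
have N0 : 0 <= N by rewrite ler0n.
set q : R := d%:R^-1.
have -> : (E / N ^+ 3) `^ q = E `^ q / (N `^ q * (N `^ q * N `^ q)).
  rewrite powRM ?invr_ge0 ?exprn_ge0 ?ler0n//; congr (_ * _).
  rewrite -(powR_inv1 (exprn_ge0 3 N0)) -powRrM mulN1r powRN; congr (_^-1).
  by rewrite !exprS expr0 mulr1 !powRM// mulr_ge0.
move: (Num.sqrt _) h0 => s s0; rewrite !invfM; move: (N `^ q)^-1 => x.
by field; rewrite gt_eqF.
Unshelve. all: by end_near. Qed.
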